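(* Let $n_1,\ldots,n_6\ge 2$ be integers and $a_i=n_i-1$ for $i\in[6]$. Then \[ m_0(1,n_1,\ldots,n_6)=B_2^{(6)}+\max_{G\in\mathcal I_6}\left(\sum_{e\in E(G)}\Delta_e+\Phi(G)\right), \] where $B_2^{(6)}:=1+\sum_{i=1}^6a_i+\sum_{1\le i<j\le 6}a_ia_j$.
   Context: Write $[r]=\{1,\ldots,r\}$. Let $X_1,\ldots,X_r$ be finite sets with $|X_i|=n_i$. A family $\mathcal F\subseteq X_1\times\cdots\times X_r$ is viewed as an $r$-partite $r$-graph with (disjoint) parts $X_1,\ldots,X_r$: a tuple $(x_1,\ldots,x_r)$ is the edge whose vertices are $x_1\in X_1,\ldots,x_r\in X_r$, so two tuples $\mathbf x,\mathbf y$ are disjoint edges if and only if $x_i\ne y_i$ for all $i\in[r]$. Let $\nu(\mathcal F)$ be the maximum number of pairwise disjoint edges in $\mathcal F$, and $\tau(\mathcal F)$ the minimum size of a vertex set meeting every edge of $\mathcal F$. The number $m_0(1,n_1,\ldots,n_r)$ is the maximum size of a family $\mathcal F\subseteq X_1\times\cdots\times X_r$ satisfying $\nu(\mathcal F)\le 1<\tau(\mathcal F)$; equivalently, any two members of $\mathcal F$ agree in at least one coordinate, and no vertex is common to all members of $\mathcal F$. Here $r=6$. For $X\subseteq[6]$ put $a_X:=\prod_{i\in X}a_i$, with $a_\emptyset:=1$. For a $2$-subset $e\in\binom{[6]}2$ write $\overline e:=[6]\setminus e$ and $\Delta_e:=a_{\overline e}-a_e$. An intersecting graph is a (simple) graph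 in which every pair of edges shares a common vertex. $\mathcal I_6$ denotes the set of all intersecting graphs on vertex set $[6]$, including the empty graph. For $G\in\mathcal I_6$ define \[ \mathcal A(G):=\left\{C\in\binom{[6]}3:\text{there is no }e\in E(G)\text{ with }e\subseteq C\right\}. \] The $3$-subsets of $[6]$ are paired by complementation, and \[ \Phi(G):=\sum_{\{C,[6]\setminus C\}}\max\Bigl(\{0\}\cup\{a_C:C\in\mathcal A(G)\}\cup\{a_{[6]\setminus C}:[6]\setminus C\in\mathcal A(G)\}\Bigr), \] where the sum runs over the unordered complementary pairs $\{C,[6]\setminus C\}$ of $3$-subsets of $[6]$, each counted once; thus each pair contributes the maximum of $0$ and the weights of those of its (at most two) members that lie in $\mathcal A(G)$. *)

(* Defs.v *)
From mathcomp Require Import all_boot all_order all_algebra.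
Set Implicit Arguments.
Unset Strict Implicit.
Unset Printing Implicit Defensive.

Import Order.TTheory GRing.Theory Num.Theory.

Section PartiteHypergraphs.
Variables (r : nat) (X : 'I_r -> finType).

(* The tagged union makes the parts disjoint even when some [X i] coincide. *)
Definition vertex : finType := {i : 'I_r & X i}.

Definition edge : finType := {dffun forall i : 'I_r, X i}.

Definition vertices_of (x : edge) : {set vertex} :=
  [set Tagged X (x i) | i : 'I_r].

Definition is_matching (M : {set edge}) : bool :=
  [forall x in M, forall y in M,
     (x != y) ==> [disjoint vertices_of x & vertices_of y]].

Definition nu (F : {set edge}) : nat :=
  \max_(M : {set edge} | (M \subset F) && is_matching M) #|M|.

Definition is_cover (F : {set edge}) (S : {set vertex}) : bool :=
  [forall x in F, ~~ [disjoint S & vertices_of x]].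

(* For [0 < r] the whole vertex set is a cover, so the minimum is genuine. *)
Definition tau (F : {set edge}) : nat :=
  #|[arg min_(S < [set: vertex] | is_cover F S) #|S|]|.

Definition m0 (s : nat) : nat :=
  \max_(F : {set edge} | nu F <= s < tau F) #|F|.

End PartiteHypergraphs.

(* A simple graph on 'I_6 is identified with its set of edges. *)
Definition is_graph (G : {set {set 'I_6}}) : bool :=
  [forall e in G, #|e| == 2].

Definition intersecting_graphs : {set {set {set 'I_6}}} :=
  [set G | is_graph G & [forall e in G, forall f in G, ~~ [disjoint e & f]]].

Definition weight (a : 'I_6 -> nat) (C : {set 'I_6}) : nat :=
  \prod_(i in C) a i.

Definition Delta (a : 'I_6 -> nat) (e : {set 'I_6}) : int :=
  ((weight a (~: e))%:Z - (weight a e)%:Z)%R.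

Definition admissible (G : {set {set 'I_6}}) : {set {set 'I_6}} :=
  [set C : {set 'I_6} | (#|C| == 3) && ~~ [exists e in G, e \subset C]].

Definition complementary_pairs : {set {set {set 'I_6}}} :=
  [set [set C; ~: C] | C : {set 'I_6} & #|C| == 3].

(* An empty [\max] is 0. *)
Definition Phi (a : 'I_6 -> nat) (G : {set {set 'I_6}}) : nat :=
  \sum_(P in complementary_pairs) \max_(C in P | C \in admissible G) weight a C.

Definition B2 (a : 'I_6 -> nat) : nat :=
  1 + \sum_(i < 6) a i + \sum_(i < 6) \sum_(j < 6 | i < j) a i * a j.

Definition graph_value (a : 'I_6 -> nat) (G : {set {set 'I_6}}) : int :=
  (\sum_(e in G) Delta a e + (Phi a G)%:Z)%R.

(* [int] has no least element; the value at the empty graph, which belongs to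
   [intersecting_graphs], serves as the default. *)
Definition max_graph_value (a : 'I_6 -> nat) : int :=
  \big[Order.max/graph_value a set0]_(G in intersecting_graphs) graph_value a G.

(* Main.v *)
Require Import Defs.
From mathcomp Require Import all_boot all_order all_algebra.
From mathcomp Require Import zify.

Set Implicit Arguments.
Unset Strict Implicit.
Unset Printing Implicit Defensive.

Import Order.TTheory GRing.Theory Num.Theory.

(** Fix a zero value in each part. Replacing a nonzero value [v] of coordinate
[i] by the zero value, whenever the result is not yet in the family, keeps the
size and the intersection property. Shift as long as the family stays without a
common vertex. If in the end the family is stable under all zeroings, its zero
sets are pairwise intersecting, and the number of tuples with zero set [Z] is
at most [a_(~: Z)]. Otherwise let [J] be the set of unstable coordinates; for
[i] in [J], shifting would make coordinate [i] constant, so only two values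
occur there and zeroing [i] is injective on the family. If [J] has three
elements, zero sets containing at least two of them do at least as well. If not,
some zero set [Z] with [i \in Z \subset J] is missed after zeroing [i] (else the
family would have a common vertex), and the family is at most as large as the
one given by the zero sets containing [i] other than [[set i]].

The weight of an intersecting set family without singletons is then read off
layer by layer: its 2-sets form the graph [G], its 4-sets avoid the complements
of edges of [G], and its 3-sets contain at most one of each complementary pair,
with admissible complement. *)

(** * Zero sets of tuples and the zeroing of coordinates *)

Section ZeroSets.
Variables (r : nat) (X : 'I_r -> finType) (o : forall i, X i).
Implicit Types (x y : edge X) (F : {set edge X}) (i : 'I_r) (K Y Z : {set 'I_r}).

Definition intersecting F := forall x y, x \in F -> y \in F -> exists i, x i = y i.

Definition nontrivial F := forall i (u : X i), exists2 x, x \in F & x i != u.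

Definition set_intersecting (T : {set {set 'I_r}}) :=
  {in T &, forall Y Z : {set 'I_r}, ~~ [disjoint Y & Z]}.

Definition no_singleton (T : {set {set 'I_r}}) := forall i, [set i] \notin T.

Definition zeroset x : {set 'I_r} := [set i | x i == o i].

Definition zero K x : edge X := [ffun i => if i \in K then o i else x i].

(** A compression: [x] moves only when its image is vacant in [F], so that distinct members keep
    distinct images. *)
Definition shift i (v : X i) F x : edge X :=
  if (x i == v) && (zero [set i] x \notin F) then zero [set i] x else x.

(* The number of values other than [o i] occurring in coordinate [i]. *)
Definition spread F i := #|[set (x : edge X) i | x in F] :\ o i|.

Lemma zero1E i j x : zero [set i] x j = if j == i then o j else x j.
Proof. by rewrite ffunE inE. Qed.

Lemma zero1_id i x : x i = o i -> zero [set i] x = x.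
Proof. by move=> xi; apply/ffunP => j; rewrite zero1E; case: eqP => // ->. Qed.

Lemma zeroset_zero1 i x : zeroset (zero [set i] x) = i |: zeroset x.
Proof. by apply/setP=> j; rewrite !inE zero1E; case: (j =P i) => [->|_] /=; rewrite ?eqxx. Qed.

(** The tuples counted form a box: its side is [[set o i]] for [i] in [Z] and [Y i] for every other
    [i]. *)
Lemma card_zeroset (Y : forall i, {set X i}) Z : (forall i, o i \notin Y i) ->
  #|[set x : edge X | (zeroset x == Z) && [forall i, x i \in o i |: Y i]]|
  = \prod_(i in ~: Z) #|Y i|.
Proof.
move=> oY.
pose A i : pred (X i) := fun u => if i \in Z then u == o i else u \in Y i.
transitivity #|(family A : simpl_pred {dffun forall i, X i})|.
  apply: eq_card => x; rewrite !inE; apply/andP/familyP.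
    move=> [/eqP zx /forallP xY] i; rewrite unfold_in /A -zx inE.
    by case/setU1P: (xY i) => [->|xi]; rewrite ?eqxx //; case: eqP => // ->; rewrite eqxx.
  move=> xA; split.
    apply/eqP/setP=> i; rewrite inE; have := xA i; rewrite unfold_in /A.
    case: (i \in Z) => // xi; apply/negP => /eqP xo.
    by move: (oY i); rewrite -xo xi.
  apply/forallP => i; apply/setU1P; have := xA i; rewrite unfold_in /A.
  by case: (i \in Z) => [/eqP|]; [left | right].
rewrite card_family foldrE big_map big_enum /= [RHS]big_mkcond /=.
apply: eq_bigr => i _; rewrite inE; case: ifPn => /=.
  by move=> iZ; apply: eq_card => u; rewrite unfold_in /A (negPf iZ).
move/negbNE => iZ; rewrite -(card1 (o i)).
by apply: eq_card => u; rewrite unfold_in /A iZ.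
Qed.

Lemma card_le_zerosets F (b : 'I_r -> nat) (P : pred {set 'I_r}) :
  (forall i, spread F i <= b i) -> (forall x, x \in F -> P (zeroset x)) ->
  #|F| <= \sum_(Z | P Z) \prod_(i in ~: Z) b i.
Proof.
move=> Fb FP; rewrite -sum1_card (partition_big zeroset P) //=.
apply: leq_sum => Z _; rewrite sum1dep_card.
pose Y i := [set (x : edge X) i | x in F] :\ o i.
have oY i : o i \notin Y i by rewrite !inE eqxx.
apply: (@leq_trans (\prod_(i in ~: Z) #|Y i|)); last by apply: leq_prod => i _; apply: Fb.
rewrite -card_zeroset //; apply/subset_leq_card/subsetP => x.
rewrite !inE => /andP[xF ->] /=; apply/forallP => i; apply/setU1P; rewrite !inE.
by case: (x i =P o i) => [|_]; [left | right; apply: (imset_f (fun y : edge X => y i))].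
Qed.

(** * A single shift of coordinate [i] from the value [v] to zero *)

Section Shift.
Variables (i : 'I_r) (v : X i) (F : {set edge X}).
Hypothesis vo : v != o i.
Local Notation sF := [set shift v F x | x in F].

Lemma shift_other x j : j != i -> shift v F x j = x j.
Proof. by move=> ji; rewrite /shift; case: ifP => // _; rewrite zero1E (negPf ji). Qed.

Lemma shift_inj : {in F &, injective (shift v F)}.
Proof.
move=> x y xF yF; rewrite /shift; case: ifP => [/andP[/eqP xv nx]|_];
  case: ifP => [/andP[/eqP yv ny]|_] // e.
- apply/ffunP => j; case: (eqVneq j i) => [->|ji]; first by rewrite xv yv.
  by move/ffunP/(_ j): e; rewrite !zero1E (negPf ji).
- by move: nx; rewrite e yF.
- by move: ny; rewrite -e xF.
Qed.

Lemma intersecting_shift : intersecting F -> intersecting sF.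
Proof.
move=> Fint.
(* The critical pair: [z] moves and [x] does not. If they meet at [i], then [x i = v], so [x] was
   blocked by its zeroed copy in [F]; that copy meets [z] outside [i], and hence so does [x]. *)
have mixed x z : x \in F -> z \in F -> z i = v ->
    (x i == v) && (zero [set i] x \notin F) = false ->
    exists j, x j = zero [set i] z j.
  move=> xF zF zv nx.
  have [j xz] : exists2 j, j != i & x j = z j.
    have [j xz] := Fint _ _ xF zF; case: (eqVneq j i) => [ji|]; last by exists j.
    subst j; move: nx; rewrite xz zv eqxx /= => /negbFE x0F.
    have [j] := Fint _ _ x0F zF; rewrite zero1E; case: (eqVneq j i) => [->|ji e].
      by move/eqP; rewrite zv eq_sym (negPf vo).
    by exists j.
  by move=> xzj; exists j; rewrite zero1E (negPf xz).
move=> _ _ /imsetP[x xF ->] /imsetP[z zF ->]; rewrite /shift.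
case: ifP => [/andP[/eqP xv nx]|xn]; case: ifP => [/andP[/eqP zv nz]|zn].
- by exists i; rewrite !zero1E eqxx.
- by have [j] := mixed z x zF xF xv zn; exists j.
- exact: mixed.
- exact: Fint.
Qed.

Lemma spread_shift j : spread sF j <= spread F j.
Proof.
apply/subset_leq_card/subsetP => u; rewrite !inE => /andP[uo].
case/imsetP=> _ /imsetP[x xF ->] ue; rewrite uo /=; move: ue uo.
rewrite /shift; case: ifP => _; last by move=> -> _; apply: imset_f.
rewrite zero1E; case: eqP => _; first by move=> ->; rewrite eqxx.
by move=> -> _; apply: imset_f.
Qed.

(** The number of nonzero entries is the induction measure of [zeroset_bound]: a shift creates none
    and removes that of [z] at [i]. *)
Lemma zeros_shift z : z \in F -> z i = v -> zero [set i] z \notin F ->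
  \sum_(x in sF) #|~: zeroset x| < \sum_(x in F) #|~: zeroset x|.
Proof.
move=> zF zv nz; rewrite big_imset /=; last exact: shift_inj.
have le x : #|~: zeroset (shift v F x)| <= #|~: zeroset x|.
  rewrite /shift; case: ifP => // _; rewrite zeroset_zero1.
  by apply: subset_leq_card; rewrite setCS subsetUr.
rewrite (bigD1 z) // [ltnRHS](bigD1 z) //= -addSn leq_add //; last exact: leq_sum.
rewrite /shift zv eqxx nz /= zeroset_zero1.
apply: proper_card; rewrite properC properEneq subsetUr andbT.
apply/eqP=> e; have: i \in zeroset z by rewrite e setU11.
by rewrite inE zv (negPf vo).
Qed.

(** A vertex common to the shifted family lies in part [i], because the other coordinates do not
    move and [F] has no common vertex. As [z] moves, this vertex is [o i], so each member was zero
    at [i] or moved. *)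
Lemma trivial_shift z (j : 'I_r) (u : X j) : nontrivial F ->
  z \in F -> z i = v -> zero [set i] z \notin F ->
  (forall x, x \in sF -> x j = u) ->
  forall x, x \in F -> x i = o i \/ x i = v /\ zero [set i] x \notin F.
Proof.
move=> Fnt zF zv nz sFu.
have ji : j = i.
  apply/eqP; apply: contraT => ji.
  have [x xF] := Fnt j u; rewrite -(shift_other x ji) (sFu _ (imset_f _ xF)).
  by rewrite eqxx.
subst j => x xF; have := sFu _ (imset_f _ xF); have := sFu _ (imset_f _ zF).
rewrite {1}/shift zv eqxx nz /= zero1E eqxx => <-.
by rewrite /shift; case: ifP => [/andP[/eqP-> ->]|_]; [right | left].
Qed.

End Shift.

Definition stable F i := forall x, x \in F -> zero [set i] x \in F.

Lemma stable_zero F K : {in K, forall i, stable F i} ->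
  forall x, x \in F -> zero K x \in F.
Proof.
move: {2}(#|K|) (erefl #|K|) => m; elim: m K => [|m IH] K Km Kst x xF.
  have -> : K = set0 by apply/eqP; rewrite -cards_eq0 Km.
  by rewrite (_ : zero _ _ = x) //; apply/ffunP=> i; rewrite ffunE inE.
have /set0Pn[i iK] : K != set0 by rewrite -cards_eq0 Km.
have -> : zero K x = zero [set i] (zero (K :\ i) x).
  by apply/ffunP=> j; rewrite zero1E !ffunE !inE; case: eqP => //= ->; rewrite iK.
apply: (Kst i iK); apply: IH => //; first by move: Km; rewrite (cardsD1 i) iK; lia.
by move=> j; rewrite inE => /andP[_]; apply: Kst.
Qed.


(** * Exchanging zero sets through coordinates of weight one *)

Lemma prod_compl_eq (b : 'I_r -> nat) Y Z :
  (forall i, b i = 1 \/ (i \in Y) = (i \in Z)) ->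
  \prod_(i in ~: Y) b i = \prod_(i in ~: Z) b i.
Proof.
move=> YZ; rewrite big_mkcond [RHS]big_mkcond; apply: eq_bigr => i _.
by rewrite !inE; case: (YZ i) => [->|->] //; case: (i \in Y); case: (i \in Z).
Qed.

(** All weights on [Z] are one, so [Z] and [[set i]] carry the same product: dropping [Z] from the
    star of [i] costs as much as dropping the forbidden singleton. *)
Lemma star_bound (b : 'I_r -> nat) i Z : i \in Z ->
  {in Z, forall j, b j = 1} ->
  exists2 T, set_intersecting T /\ no_singleton T &
    \sum_(Y : {set 'I_r} | (i \in Y) && (Y != Z)) \prod_(j in ~: Y) b j
    = \sum_(Y in T) \prod_(j in ~: Y) b j.
Proof.
move=> iZ Z1; exists [set Y : {set 'I_r} | (i \in Y) && (Y != [set i])].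
  split=> [U V|j]; rewrite !inE.
    move=> /andP[iU _] /andP[iV _].
    by apply/pred0Pn; exists i; rewrite /= iU iV.
  by case: eqP => //= ->; rewrite eqxx.
rewrite [RHS](eq_bigl (fun Y : {set 'I_r} => (i \in Y) && (Y != [set i]))); last first.
  by move=> Y; rewrite inE.
have e : \prod_(j in ~: Z) b j = \prod_(j in ~: [set i]) b j.
  apply: prod_compl_eq => j; case: (boolP (j \in Z)) => jZ; first by left; apply: Z1.
  by right; rewrite inE; apply/esym/negP => /eqP ji; rewrite ji iZ in jZ.
apply: (@addnI (\prod_(j in ~: Z) b j)).
rewrite -(bigD1 Z) // e -(bigD1 [set i]) //; exact: set11.
Qed.

(** Flipping membership of [i], [j] and [k], all of weight one, preserves the product and turns the
    sets containing only [i] among them into those containing [j] and [k] but not [i]. So the star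
    of [i] weighs as much as the intersecting family of sets with at least two of the three. *)
Lemma majority_bound (b : 'I_r -> nat) i j k :
  i != j -> i != k -> j != k -> b i = 1 -> b j = 1 -> b k = 1 ->
  exists2 T, set_intersecting T /\ no_singleton T &
    \sum_(Y : {set 'I_r} | i \in Y) \prod_(l in ~: Y) b l
    = \sum_(Y in T) \prod_(l in ~: Y) b l.
Proof.
move=> ij ik jk bi bj bk.
pose m (Y : {set 'I_r}) := [|| (i \in Y) && (j \in Y), (i \in Y) && (k \in Y)
                             | (j \in Y) && (k \in Y)].
exists [set Y | m Y].
  split=> [U V|l]; rewrite !inE /m.
    move=> mU mV; apply/pred0Pn.
    have [l /andP[lU lV]] : exists l, (l \in U) && (l \in V).
      move: mU mV; case iU: (i \in U); case jU: (j \in U); case kU: (k \in U) => //=;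
      case iV: (i \in V); case jV: (j \in V); case kV: (k \in V) => //= _ _;
      (by exists i; rewrite iU iV) || (by exists j; rewrite jU jV)
        || (by exists k; rewrite kU kV).
    by exists l; rewrite /= lU lV.
  rewrite !inE; apply/negP => /or3P[] /andP[/eqP e1 /eqP e2];
    by move: ij ik jk; rewrite e1 e2 eqxx.
rewrite [RHS](eq_bigl m); last by move=> Y; rewrite inE.
rewrite (bigID m) [RHS](bigID (fun Y : {set 'I_r} => i \in Y)) /=; congr (_ + _).
  by apply: eq_bigl => Y; rewrite andbC.
pose K := [set i; j; k].
pose h (Y : {set 'I_r}) := (Y :\: K) :|: (K :\: Y).
have hE l Y : (l \in h Y) = (l \in K) (+) (l \in Y).
  by rewrite in_setU !in_setD; case: (l \in Y); case: (l \in K).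
have hK : involutive h.
  by move=> Y; apply/setP => l; rewrite !hE addbA addbb.
rewrite (reindex_inj (inv_inj hK)) /=; apply: eq_big => [Y|Y _].
  rewrite /m !hE !inE !eqxx !orbT /=.
  by case: (i \in Y); case: (j \in Y); case: (k \in Y).
apply: prod_compl_eq => l; rewrite hE !inE.
case: eqP => [->|_]; first by left.
case: eqP => [->|_]; first by left.
by case: eqP => [->|_]; [left | right].
Qed.

(** * Bounding families of tuples by families of zero sets *)

Lemma stable_zeroset_bound F : intersecting F -> nontrivial F ->
  (forall i, stable F i) ->
  exists2 T, set_intersecting T /\ no_singleton T &
    #|F| <= \sum_(Z in T) \prod_(i in ~: Z) spread F i.
Proof.
move=> Fint Fnt Fst; exists [set zeroset x | x in F]; last first.
  by apply: card_le_zerosets => // x xF; apply: imset_f.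
split=> [_ _ /imsetP[x xF ->] /imsetP[y yF ->]|i].
  (* Once zeroed outside [zeroset y], [x] differs from [y] there; the two must meet inside it, at a
     common zero of [x] and [y]. *)
  have x'F : zero (~: zeroset y) x \in F by apply: stable_zero.
  have [l] := Fint _ _ x'F yF; rewrite ffunE !inE.
  case: eqP => //= [yl xl|yl e]; last by case: yl.
  by apply/pred0Pn; exists l; rewrite /= !inE xl yl eqxx.
apply/negP => /imsetP[x xF xi].
have [y yF /eqP] := Fnt i (o i); apply.
have y'F : zero (~: [set i]) y \in F by apply: stable_zero.
have [l] := Fint _ _ y'F xF; rewrite ffunE !inE.
have := in_set1 l i; rewrite xi inE.
by case: (l =P i) => [-> /eqP -> //|_ /= /eqP xl e]; case: xl.
Qed.

Lemma nonstable_zeroset_bound F : intersecting F -> nontrivial F ->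
  ~ (forall i, stable F i) ->
  (forall i, ~ stable F i -> exists v : X i,
     forall x, x \in F -> x i = o i \/ x i = v /\ zero [set i] x \notin F) ->
  exists2 T, set_intersecting T /\ no_singleton T &
    #|F| <= \sum_(Z in T) \prod_(i in ~: Z) spread F i.
Proof.
move=> Fint Fnt Fnst F2.
pose stb i := [forall x in F, zero [set i] x \in F].
have stP i : reflect (stable F i) (stb i) by apply: forall_inP.
pose J := [set i | ~~ stb i].
have JP i : i \in J -> ~ stable F i by rewrite inE => /negP H /stP.
have spread1 i : i \in J -> spread F i = 1.
  move=> /JP /F2[v Fv]; apply/eqP; rewrite eqn_leq; apply/andP; split.
    rewrite -(cards1 v); apply/subset_leq_card/subsetP => u; rewrite !inE.
    move=> /andP[uo /imsetP[x xF e]]; move: uo; rewrite e.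
    by case: (Fv x xF) => [->|[-> _]]; rewrite eqxx.
  have [x xF xo] := Fnt i (o i); apply/card_gt0P; exists (x i).
  by rewrite !inE xo (imset_f (fun y : edge X => y i)).
have [i iJ] : exists i, i \in J.
  apply/existsP; apply: contraT; rewrite negb_exists => /forallP H.
  by case: Fnst => i; apply/stP; have := H i; rewrite inE negbK.
have [v Fv] := F2 i (JP i iJ).
pose F1 := [set zero [set i] x | x in F].
(* Zeroing [i] is injective on [F]: a member with value [v] has its image outside [F], while a
   member already zero at [i] is its own image. *)
have cF1 : #|F1| = #|F|.
  apply: card_in_imset => x y xF yF e.
  have xy : x i = y i.
    case: (Fv x xF) (Fv y yF) => [xo|[xv nx]] [yo|[yv ny]]; rewrite ?xo ?xv ?yo ?yv //.
      by case/negP: ny; rewrite -e zero1_id.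
    by case/negP: nx; rewrite e zero1_id.
  apply/ffunP => j; case: (eqVneq j i) => [->|ji] //.
  by move/ffunP/(_ j): e; rewrite !zero1E (negPf ji).
have sF1 j : spread F1 j <= spread F j.
  apply/subset_leq_card/subsetP => u; rewrite !inE => /andP[uo].
  case/imsetP=> _ /imsetP[x xF ->] ue; rewrite uo /=; move: ue uo.
  rewrite zero1E; case: eqP => _; first by move=> ->; rewrite eqxx.
  by move=> -> _; apply: (imset_f (fun y : edge X => y j)).
have iF1 x : x \in F1 -> i \in zeroset x.
  by case/imsetP => y _ ->; rewrite zeroset_zero1 setU11.
rewrite -cF1.
have [/existsP[Z /and3P[iZ ZJ nZ]]|full] := boolP [exists Z : {set 'I_r},
    [&& i \in Z, Z \subset J & [forall x in F1, zeroset x != Z]]].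
  have [||T Tint Te] := @star_bound (spread F) i Z; rewrite ?iZ //.
    by move=> j jZ; apply: spread1; apply: (subsetP ZJ).
  exists T => //; rewrite -Te; apply: card_le_zerosets => // x xF1.
  by rewrite iF1 //=; apply: (forall_inP nZ).
have hit Z : i \in Z -> Z \subset J ->
    exists2 x, x \in F & i |: zeroset x = Z.
  move=> iZ ZJ; move: full; rewrite negb_exists => /forallP/(_ Z).
  rewrite iZ ZJ /= negb_forall => /existsP[y]; rewrite negb_imply negbK.
  by case/andP=> /imsetP[x xF ->] /eqP; rewrite zeroset_zero1; exists x.
(* Zeroing [y] outside [J] stays in [F], so [x], which has no zero there, must
   agree with [y] inside [J]. *)
have agree x y : x \in F -> i |: zeroset x \subset J -> y \in F ->
    exists2 l, l \in J & x l = y l.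
  move=> xF xJ yF.
  have y'F : zero (~: J) y \in F.
    by apply: stable_zero yF => j; rewrite !inE negbK => /stP.
  have [l] := Fint _ _ xF y'F; rewrite ffunE in_setC.
  case: (boolP (l \in J)) => [lJ e|lJ e]; first by exists l.
  by case/negP: lJ; apply: (subsetP xJ); rewrite !inE e eqxx orbT.
have [/existsP[j /existsP[k /and5P[ij ik jk jJ kJ]]]|few] := boolP
    [exists j, exists k, [&& i != j, i != k, j != k, j \in J & k \in J]].
  have [|||T Tint Te] := @majority_bound (spread F) i j k ij ik jk; try exact: spread1.
  by exists T => //; rewrite -Te; apply: card_le_zerosets.
(* Now [J] has at most two elements and every set between [[set i]] and [J] is hit. This would make
   the value [x i] below common to all members. *)
exfalso.
have iJ1 : [set i] \subset J by rewrite sub1set.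
have [x xF ex] := hit [set i] (set11 i) iJ1.
have xJ : i |: zeroset x \subset J by rewrite ex sub1set.
have [/existsP[k /andP[ik kJ]]|J1] := boolP [exists k, (i != k) && (k \in J)]; last first.
  have [y yF yi] := Fnt i (x i); have [l lJ xl] := agree x y xF xJ yF.
  case: (eqVneq i l) => [il|il]; first by subst l; rewrite xl eqxx in yi.
  by case/negP: J1; apply/existsP; exists l; rewrite il lJ.
have Jik l : l \in J -> l = i \/ l = k.
  move=> lJ; case: (eqVneq i l) => [|il]; first by left.
  case: (eqVneq k l) => [|kl]; first by right.
  case/negP: few; apply/existsP; exists k; apply/existsP; exists l.
  by rewrite ik il kl kJ lJ.
have ikJ : [set i; k] \subset J by rewrite subUset !sub1set iJ kJ.
(* At [k], [x] is nonzero and [z] is zero, so they agree at [i]; a member differing from them at [i]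
   would have to equal both at [k]. *)
have [z zF ez] := hit [set i; k] (set21 i k) ikJ.
have zJ : i |: zeroset z \subset J by rewrite ez.
have xk : x k != o k.
  have := in_set1 k i; rewrite -[[set i]]ex !inE eq_sym (negPf ik) /=.
  by move=> ->.
have zk : z k = o k.
  have := set22 i k; rewrite -[[set i; k]]ez !inE eq_sym (negPf ik) /=.
  by move/eqP.
have xzi : x i = z i.
  have [l /Jik[->|->] //] := agree x z xF xJ zF.
  by move=> e; move: xk; rewrite e zk eqxx.
have [y yF yi] := Fnt i (x i).
have xyk : x k = y k.
  have [l /Jik[->|->] //] := agree x y xF xJ yF.
  by move=> e; rewrite e eqxx in yi.
have [l /Jik[->|->]] := agree z y zF zJ yF; first by rewrite -xzi => e; rewrite e eqxx in yi.
by rewrite -xyk zk => e; rewrite e eqxx in xk.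
Qed.

Theorem zeroset_bound F : intersecting F -> nontrivial F ->
  exists2 T, set_intersecting T /\ no_singleton T &
    #|F| <= \sum_(Z in T) \prod_(i in ~: Z) spread F i.
Proof.
have [m] := ubnP (\sum_(x in F) #|~: zeroset x|).
elim: m F => // m IH F /ltnSE Fm Fint Fnt.
pose stb F i := [forall x in F, zero [set i] x \in F].
have [/existsP[i]|good] := boolP [exists i, exists x in F,
  [&& zero [set i] x \notin F & [forall j, forall u : X j,
     exists y in [set shift (x i) F z | z in F], y j != u]]].
  case/exists_inP => z zF /andP[nz /forallP snt].
  have vo : z i != o i by apply: contra nz => /eqP zi; rewrite zero1_id.
  have [|||T Tint le] := IH [set shift (z i) F x | x in F].
  - exact: leq_trans (zeros_shift vo zF _ nz) Fm.
  - exact: intersecting_shift.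
  - by move=> j u; have /forallP/(_ u)/exists_inP := snt j.
  exists T => //; rewrite -(card_in_imset (@shift_inj i (z i) F)).
  apply: leq_trans le _; apply: leq_sum => Z _; apply: leq_prod => j _.
  exact: spread_shift.
have [/forallP Fst|Fnst] := boolP [forall i, stb F i].
  by apply: stable_zeroset_bound => // i x xF; apply: (forall_inP (Fst i)).
apply: nonstable_zeroset_bound => //.
  by move=> Fst; case/negP: Fnst; apply/forallP => i; apply/forall_inP; apply: Fst.
move=> i nst.
have [z zF nz] : exists2 z, z \in F & zero [set i] z \notin F.
  by apply/exists_inP; apply: contraT; rewrite negb_exists_in => /forall_inP H;
     case: nst => x xF; apply: negbNE; apply: H.
have vo : z i != o i by apply: contra nz => /eqP zi; rewrite zero1_id.
(* Shifting away the value [z i] would create a common vertex, so [z i] is the only nonzero value at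
   [i]. *)
exists (z i); move: good; rewrite negb_exists => /forallP/(_ i).
rewrite negb_exists_in => /forall_inP/(_ z zF); rewrite nz /= negb_forall.
case/existsP => j; rewrite negb_forall => /existsP[u].
rewrite negb_exists_in => /forall_inP ju.
have sFu := trivial_shift (j := j) (u := u) Fnt zF erefl nz; apply: sFu => x xs.
by apply/eqP; apply: negbNE; apply: ju.
Qed.

End ZeroSets.

(** * Weights of intersecting families of subsets of ['I_6] *)

Section SetFamilies.
Variable a : 'I_6 -> nat.
Implicit Types (T G : {set {set 'I_6}}) (C D Y Z e : {set 'I_6}).

Definition edges_of T := [set e in T | #|e| == 2].

Lemma card_setC6 C : #|~: C| = 6 - #|C|.
Proof. by have := cardsC C; rewrite card_ord; lia. Qed.

Lemma disjoint_setC6 Y Z : #|Y| + #|Z| = 6 -> [disjoint Y & Z] -> Z = ~: Y.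
Proof.
move=> YZ; rewrite disjoint_sym disjoints_subset => ZY; apply/eqP.
by rewrite eqEcard ZY card_setC6; lia.
Qed.

Lemma sum_weight1 : \sum_(C : {set 'I_6} | #|C| == 1) weight a C = \sum_i a i.
Proof.
rewrite (eq_bigl [in [set [set i] | i in 'I_6]]); last first.
  by move=> C; apply/cards1P/imsetP => [[i ->]|[i _ ->]]; exists i.
rewrite big_imset /=; last by move=> i j _ _; apply: set1_inj.
by apply: eq_bigr => i _; rewrite /weight big_set1.
Qed.

Lemma sum_weight2 :
  \sum_(C : {set 'I_6} | #|C| == 2) weight a C
  = \sum_(i < 6) \sum_(j < 6 | i < j) a i * a j.
Proof.
rewrite pair_big_dep /=.
pose P := [set p : 'I_6 * 'I_6 | p.1 < p.2].
rewrite (eq_bigl [in [set [set p.1; p.2] | p in P]]); last first.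
  move=> C; apply/cards2P/imsetP => [[i [j [ij ->]]]|[[i j]]]; last first.
    by rewrite inE /= => ij ->; exists i, j; split=> //; apply: contraL ij => /eqP->; rewrite ltnn.
  have [lt|gt|e] := ltngtP i j; last by rewrite (val_inj e) eqxx in ij.
    by exists (i, j); rewrite ?inE.
  by exists (j, i); rewrite ?inE // setUC.
rewrite big_imset /=; last first.
  move=> [i j] [k l]; rewrite !inE /= => ij kl e.
  have := set21 i j; have := set22 i j; rewrite e !inE.
  have := set21 k l; have := set22 k l; rewrite -e !inE -!val_eqE /= => h1 h2 h3 h4.
  by congr pair; apply: val_inj => /=; lia.
apply: eq_big => [[i j]|[i j]]; rewrite inE //= => ij.
by rewrite /weight big_setU1 ?big_set1 // inE -val_eqE /=; lia.
Qed.

(** Under complementation these are the sets of size at least four, so [B2] is their total weight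
    before edges exclude any 4-set. *)
Lemma B2E : B2 a = \sum_(C : {set 'I_6} | #|C| <= 2) weight a C.
Proof.
rewrite (bigID (fun C => #|C| == 2)) /= [X in _ = _ + X](bigID (fun C => #|C| == 1)) /=.
rewrite /B2 -sum_weight1 -sum_weight2 addnC; congr addn.
  by apply: eq_bigl => C; move: #|C| => m; lia.
rewrite [LHS]addnC; congr addn; first by apply: eq_bigl => C; move: #|C| => m; lia.
rewrite (big_pred1 set0) /weight ?big_set0 // => C.
by rewrite /= -cards_eq0; move: #|C| => m; lia.
Qed.

Lemma PhiE G : Phi a G = \sum_(C : {set 'I_6} | (#|C| == 3) && (ord0 \in C))
  maxn (if C \in admissible G then weight a C else 0)
       (if ~: C \in admissible G then weight a (~: C) else 0).
Proof.
have -> : Phi a G =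
    \sum_(P in [set [set C; ~: C] | C in [set C : {set 'I_6} | (#|C| == 3) && (ord0 \in C)]])
      \max_(C in P | C \in admissible G) weight a C.
  apply: eq_bigl => P; apply/imsetP/imsetP => [[C]|[C]]; rewrite !inE.
    move=> C3 ->; case: (boolP (ord0 \in C)) => C0; first by exists C; rewrite // inE C3.
    exists (~: C); last by rewrite setCK setUC.
    by rewrite !inE C0 card_setC6 (eqP C3).
  by case/andP=> C3 _ ->; exists C; rewrite // inE.
rewrite big_imset /=; last first.
  move=> C D; rewrite !inE => /andP[_ C0] /andP[_ D0] e.
  have := set21 C (~: C); rewrite e !inE => /orP[/eqP //|/eqP CD].
  by move: C0; rewrite CD inE D0.
apply: eq_big => [C|C]; rewrite inE // => /andP[_ C0].
rewrite big_mkcondr big_setU1 ?big_set1 //= inE.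
by apply/eqP => e; have := C0; rewrite e inE C0.
Qed.

Lemma sum_weight3 (Q : pred {set 'I_6}) :
  \sum_(C : {set 'I_6} | (#|C| == 3) && Q C) weight a C =
  \sum_(C : {set 'I_6} | (#|C| == 3) && (ord0 \in C))
    ((if Q C then weight a C else 0) + (if Q (~: C) then weight a (~: C) else 0)).
Proof.
rewrite big_split /= -!big_mkcondr /=.
rewrite (bigID (fun C => ord0 \in C)) /=; congr addn.
  by apply: eq_bigl => C; rewrite andbAC.
rewrite [LHS](reindex_inj (@setC_inj _)); apply: eq_bigl => C /=.
by rewrite card_setC6 inE negbK andbAC; congr (_ && _ && _); move: #|C| => m; lia.
Qed.

Lemma sum_weight_layers T : (forall Z, Z \in T -> 1 < #|Z|) ->
  \sum_(Z in T) weight a (~: Z)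
  = \sum_(C : {set 'I_6} | (#|C| <= 2) && (~: C \in T)) weight a C
    + \sum_(C : {set 'I_6} | (#|C| == 3) && (~: C \in T)) weight a C
    + \sum_(e in edges_of T) weight a (~: e).
Proof.
move=> T1; rewrite (bigID (fun Z => 4 <= #|Z|)) -addnA /=; congr addn.
  rewrite (reindex_inj (@setC_inj _)); apply: eq_big => [C|C _]; rewrite ?setCK //.
  by rewrite card_setC6 andbC; congr andb; move: #|C| => m; lia.
rewrite (bigID (fun Z => #|Z| == 3)) /=; congr addn.
  rewrite (reindex_inj (@setC_inj _)); apply: eq_big => [C|C _]; rewrite ?setCK //.
  by rewrite card_setC6 -andbA andbC; congr andb; move: #|C| => m; lia.
apply: eq_bigl => Z; rewrite inE -andbA; case: (boolP (Z \in T)) => //= /T1; move: #|Z| => m; lia.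
Qed.

Lemma Delta_sum G : (\sum_(e in G) Delta a e)%R =
  ((\sum_(e in G) weight a (~: e))%:Z - (\sum_(e in G) weight a e)%:Z)%R.
Proof. by rewrite GRing.sumrB -!(big_morph Posz PoszD (erefl _)). Qed.

Lemma set_intersecting_le T : set_intersecting T -> no_singleton T ->
  edges_of T \in intersecting_graphs /\
  ((\sum_(Z in T) weight a (~: Z))%:Z <= (B2 a)%:Z + graph_value a (edges_of T))%R.
Proof.
move=> Tint T1; set G := edges_of T.
have GT e : e \in G -> e \in T by rewrite inE => /andP[].
split.
  rewrite inE; apply/andP; split; first by apply/forall_inP => e; rewrite inE => /andP[].
  by apply/forall_inP => e eG; apply/forall_inP => f fG; apply: Tint; apply: GT.
have T_gt1 Z : Z \in T -> 1 < #|Z|.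
  move=> ZT; have := Tint Z Z ZT ZT; rewrite -setI_eq0 setIid -card_gt0 => Z0.
  by rewrite ltn_neqAle Z0 andbT eq_sym; apply/cards1P => -[i e]; case/negP: (T1 i); rewrite -e.
(* An edge [e] excludes its complement, whose weight is [weight a e]: this is the negative term of
   [Delta]. *)
have le2 : \sum_(C : {set 'I_6} | (#|C| <= 2) && (~: C \in T)) weight a C
    + \sum_(e in G) weight a e <= B2 a.
  rewrite B2E [leqRHS](bigID (fun C => ~: C \in T)) /= leq_add2l.
  rewrite big_mkcond [leqRHS]big_mkcond; apply: leq_sum => e _.
  case: ifP => // eG; rewrite ifT //; have := eG; rewrite inE => /andP[eT /eqP ->] /=.
  apply/negP => e'T; have := Tint e (~: e) eT e'T.
  by rewrite disjoints_subset setCK subxx.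
(* A 3-set of [T] meets every edge, so its complement contains none. Since [T] has at most one
   member of each pair, the two terms of a pair add up to at most their maximum. *)
have le3 : \sum_(C : {set 'I_6} | (#|C| == 3) && (~: C \in T)) weight a C <= Phi a G.
  rewrite PhiE sum_weight3; apply: leq_sum => C /andP[/eqP C3 _].
  have adm D : #|D| = 3 -> ~: D \in T -> D \in admissible G.
    move=> D3 D'T; rewrite inE D3 eqxx /=; apply/negP => /exists_inP[e eG eD].
    have := Tint e (~: D) (GT e eG) D'T.
    by rewrite disjoints_subset setCK eD.
  have C'3 : #|~: C| = 3 by rewrite card_setC6 C3.
  case: ifP => [CT|_]; last by case: ifP => // CT; rewrite (adm (~: C)) // leq_maxr.
  rewrite (adm C) //; case: ifP => [C'T|_]; last by rewrite addn0 leq_maxl.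
  by have := Tint (~: C) (~: ~: C) CT C'T; rewrite disjoints_subset setCK subxx.
rewrite /graph_value Delta_sum (sum_weight_layers T_gt1) -/G.
by move: le2 le3; lia.
Qed.

(* The tie-break on [ord0] makes exactly one member of each complementary pair
   with an admissible member selected. *)
Definition selected G C :=
  (C \in admissible G) && ((~: C \in admissible G) ==>
    ((weight a (~: C) < weight a C)
     || (weight a (~: C) == weight a C) && (ord0 \in C))).

(** The converse construction: each layer is as heavy as the bounds in [set_intersecting_le] allow
    for the graph [G]. *)
Definition zerosets_of G := [set Z : {set 'I_6} |
  [|| 4 < #|Z|, (#|Z| == 4) && (~: Z \notin G),
      (#|Z| == 3) && selected G (~: Z) | Z \in G]].

Section Graph.
Variable G : {set {set 'I_6}}.
Hypothesis Gint : G \in intersecting_graphs.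

Lemma card_graph_edge e : e \in G -> #|e| = 2.
Proof. by move: Gint; rewrite inE => /andP[/forall_inP G2 _] /G2/eqP. Qed.

Lemma zerosets_of_gt1 Z : Z \in zerosets_of G -> 1 < #|Z|.
Proof.
rewrite inE => /or4P[|/andP[]|/andP[]|/card_graph_edge]; lia.
Qed.

Lemma edges_of_zerosets_of : edges_of (zerosets_of G) = G.
Proof.
apply/setP => e; rewrite !inE; case: (boolP (e \in G)) => [/card_graph_edge->|eG].
  by rewrite !orbT.
by case: (#|e| =P 2) => [->|_]; rewrite ?andbF.
Qed.

Lemma zerosets_of_intersecting : set_intersecting (zerosets_of G).
Proof.
have edge2 Z : Z \in zerosets_of G -> #|Z| = 2 -> Z \in G.
  by move=> ZT Z2; rewrite -edges_of_zerosets_of in_set ZT Z2.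
(* If [Y] and [Z] were disjoint, their sizes would be 2 and 2, 4 and 2, 3 and 2, or 3 and 3. The
   first contradicts that [G] is intersecting, the others contradict the condition on 4-sets,
   admissibility and the tie-break, respectively. *)
have half Y Z : Y \in zerosets_of G -> Z \in zerosets_of G ->
    #|Z| <= #|Y| -> ~~ [disjoint Y & Z].
  move=> YT ZT ZY; apply/negP => YZ.
  have ZsY : Z \subset ~: Y by rewrite -disjoints_subset disjoint_sym.
  have [Z1 Y1] := (zerosets_of_gt1 ZT, zerosets_of_gt1 YT).
  have Y4 : #|Y| + #|Z| <= 6 by have := subset_leq_card ZsY; rewrite card_setC6; lia.
  have [Y2|Y2] := eqVneq #|Y| 2.
    move: Gint; rewrite inE => /andP[_ /forall_inP/(_ Y (edge2 Y YT Y2))].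
    by move/forall_inP/(_ Z); rewrite YZ edge2 //; [move/(_ isT) | lia].
  have YG : Y \notin G by apply: contra Y2 => /card_graph_edge->.
  have [Z2|Z2] := eqVneq #|Z| 2.
    have ZG := edge2 Z ZT Z2; move: YT; rewrite inE (negPf YG) orbF => /or3P[|/andP[Y4' ]|].
    - by lia.
    - by rewrite -(disjoint_setC6 _ YZ) ?ZG //; lia.
    case/andP=> _ /andP[]; rewrite inE => /andP[_ /negP[]].
    by apply/exists_inP; exists Z.
  have [Y3 Z3] : #|Y| = 3 /\ #|Z| = 3 by lia.
  have ZG : Z \notin G by apply: contra Z2 => /card_graph_edge->.
  have ZE : Z = ~: Y by apply: disjoint_setC6 YZ; lia.
  move: ZT YT; rewrite !inE ZE card_setC6 Y3 -ZE (negPf YG) (negPf ZG) /= !orbF.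
  rewrite ZE setCK /selected setCK => /andP[-> /=] h /andP[adm' h'].
  move: h h'; rewrite adm' /= inE; case: (ord0 \in Y); lia.
move=> Y Z YT ZT; case: (leqP #|Z| #|Y|) => [|/ltnW] le; first exact: half.
by rewrite disjoint_sym half.
Qed.

Lemma zerosets_of_weight :
  ((\sum_(Z in zerosets_of G) weight a (~: Z))%:Z = (B2 a)%:Z + graph_value a G)%R.
Proof.
have eq2 : \sum_(C : {set 'I_6} | (#|C| <= 2) && (~: C \in zerosets_of G)) weight a C
    + \sum_(e in G) weight a e = B2 a.
  rewrite B2E [RHS](bigID (fun C => ~: C \in zerosets_of G)) /=; congr addn.
  apply: eq_bigl => C; rewrite !inE setCK card_setC6.
  case: (boolP (C \in G)) => [CG|CG].
    rewrite (card_graph_edge CG) /=; apply/esym/negP => /card_graph_edge.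
    by rewrite card_setC6 (card_graph_edge CG).
  by rewrite andbT; apply/esym/negP => /andP[C2]; rewrite !negb_or => /and4P[h1 h2 _ _]; move: C2 h1 h2; move: #|C| => m; lia.
have eq3 : \sum_(C : {set 'I_6} | (#|C| == 3) && (~: C \in zerosets_of G)) weight a C
    = Phi a G.
  rewrite PhiE sum_weight3; apply: eq_bigr => C /andP[/eqP C3 C0].
  have C'3 : #|~: C| = 3 by rewrite card_setC6 C3.
  have mem D : #|D| = 3 -> (~: D \in zerosets_of G) = selected G D.
    move=> D3; rewrite inE card_setC6 D3 /= setCK.
    case: (boolP (~: D \in G)) => [/card_graph_edge|_]; last by rewrite orbF.
    by rewrite card_setC6 D3.
  have C'0 : (ord0 \in ~: C) = false by rewrite inE C0.
  rewrite !mem // /selected setCK C0 C'0 andbT andbF orbF.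
  case: (C \in admissible G); case: (~: C \in admissible G);
    rewrite /= ?maxn0 ?max0n ?addn0 //.
  by case: ltngtP; rewrite ?addn0.
rewrite /graph_value Delta_sum (sum_weight_layers zerosets_of_gt1).
rewrite edges_of_zerosets_of -eq2 -eq3.
move: (\sum_(C : {set 'I_6} | (#|C| <= 2) && _) _) (\sum_(C : {set 'I_6} | (#|C| == 3) && _) _).
by move: (\sum_(e in G) weight a (~: e)) (\sum_(e in G) weight a e); lia.
Qed.

End Graph.
End SetFamilies.

(** * Families of all tuples with prescribed zero sets *)

Section ZeroSetFamilies.
Variables (r : nat) (X : 'I_r -> finType) (o : forall i, X i).
Implicit Types (T : {set {set 'I_r}}) (F : {set edge X}).

Lemma spread_le F i : spread o F i <= #|X i|.-1.
Proof.
rewrite -(cardC1 (o i)) -(@cardsE _ (predC1 (o i))); apply/subset_leq_card/subsetP => u.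
by rewrite !inE => /andP[].
Qed.

Lemma card_zeroset_preim T :
  #|[set x : edge X | zeroset o x \in T]|
  = \sum_(Z in T) \prod_(i in ~: Z) #|X i|.-1.
Proof.
rewrite -sum1_card (partition_big (zeroset o) (mem T)) /=; last first.
  by move=> x; rewrite inE.
apply: eq_bigr => Z ZT; rewrite sum1dep_card.
rewrite -(eq_bigr _ (fun i _ => cardsC1 (o i))).
rewrite -(card_zeroset (o := o) (Y := fun i => [set~ o i])); last by move=> i; rewrite !inE eqxx.
apply: eq_card => x; rewrite !inE; case: eqP => [->|_]; rewrite ?andbF //= ZT.
by apply/esym/forallP => i; rewrite !inE orbN.
Qed.

Lemma intersecting_zeroset_preim T : set_intersecting T ->
  intersecting [set x : edge X | zeroset o x \in T].
Proof.
move=> Tint x y; rewrite !inE => xT yT; have /pred0Pn[i] := Tint _ _ xT yT.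
by rewrite /= !inE => /andP[/eqP xi /eqP yi]; exists i; rewrite xi yi.
Qed.

(** The all-zero tuple avoids each nonzero vertex, and a tuple nonzero only at [i] avoids [o i];
    their zero sets have [r] and [r.-1] elements. *)
Lemma nontrivial_zeroset_preim T : (forall i, 1 < #|X i|) ->
  (forall Z : {set 'I_r}, r.-1 <= #|Z| -> Z \in T) ->
  nontrivial [set x : edge X | zeroset o x \in T].
Proof.
move=> X2 TZ i u; have [uo|uo] := eqVneq u (o i); last first.
  exists [ffun j => o j] => //; last by rewrite ffunE eq_sym.
  rewrite inE; apply: TZ; rewrite (_ : zeroset _ _ = setT) ?cardsT ?card_ord ?leq_pred //.
  by apply/setP => j; rewrite !inE ffunE eqxx.
have [p po] : exists p : forall j, X j, forall j, p j != o j.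
  apply: (fin_all_exists (P := fun j (q : X j) => q != o j)) => j.
  have /card_gt1P[s [t [_ _ st]]] := X2 j.
  by have [so|] := eqVneq s (o j); [exists t; rewrite -so eq_sym | exists s].
exists [ffun j => if j == i then p j else o j]; last by rewrite ffunE eqxx uo po.
rewrite inE; apply: TZ; rewrite (_ : zeroset _ _ = [set~ i]) ?cardsC1 ?card_ord //.
apply/setP => j; rewrite !inE ffunE; case: (j =P i) => _; last by rewrite eqxx.
by rewrite (negPf (po j)).
Qed.

End ZeroSetFamilies.

(** * Matching and covering numbers as agreement conditions on tuples *)

Section MatchingCover.
Variables (r : nat) (X : 'I_r -> finType).
Implicit Types (x y : edge X) (F : {set edge X}).

Lemma mem_vertices_of x i (u : X i) : (Tagged X u \in vertices_of x) = (x i == u).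
Proof.
apply/imsetP/eqP => [[j _ e]|<-]; last by exists i.
have ij : i = j := congr1 tag e; subst j.
by move/eqP: e; rewrite eq_Tagged => /eqP.
Qed.

Lemma vertices_ofP x y :
  reflect (exists i, x i = y i) (~~ [disjoint vertices_of x & vertices_of y]).
Proof.
apply: (iffP pred0Pn) => [[[i u]]|[i xy]].
  rewrite /= -[existT _ _ _]/(Tagged X u) !mem_vertices_of => /andP[/eqP xu /eqP yu].
  by exists i; rewrite xu yu.
by exists (Tagged X (x i)); rewrite /= !mem_vertices_of xy eqxx.
Qed.

Lemma nu_le1P F : 0 < r -> nu F <= 1 <-> intersecting F.
Proof.
move=> r0; split=> [/bigmax_leqP Fnu x y xF yF|Fint].
  have [->|xy] := eqVneq x y; first by exists (Ordinal r0).
  apply/vertices_ofP/negP => dxy.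
  suff Mm : is_matching [set x; y].
    have := Fnu [set x; y].
    by rewrite cards2 xy subUset !sub1set xF yF Mm => /(_ isT).
  apply/forall_inP => s; rewrite !inE => sxy.
  apply/forall_inP => t; rewrite !inE => txy; apply/implyP.
  by case/orP: sxy => /eqP->; case/orP: txy => /eqP->;
    rewrite ?eqxx // 1?disjoint_sym.
apply/bigmax_leqP => M /andP[MF /forall_inP Mm]; rewrite leqNgt.
apply/negP => /card_gt1P[x [y [xM yM xy]]].
have /forall_inP/(_ y yM) := Mm x xM; rewrite xy /=.
by apply/negP/vertices_ofP/Fint; apply: (subsetP MF).
Qed.

Lemma tau_gt1P F : vertex X -> 1 < tau F <-> nontrivial F.
Proof.
move=> v0; rewrite /tau; have coverT : is_cover F [set: vertex X].
  apply/forall_inP => x _; apply/pred0Pn; exists (Tagged X (x (tag v0))).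
  by rewrite /= !inE mem_vertices_of eqxx.
case: arg_minnP => // S Scov Smin; split=> [S1 i u|Fnt].
  apply/exists_inP; apply: contraLR S1; rewrite negb_exists_in -leqNgt => /forall_inP Fu.
  rewrite -(cards1 (Tagged X u)); apply: Smin; apply/forall_inP => x xF.
  apply/pred0Pn; exists (Tagged X u).
  by rewrite /= in_set1 eqxx mem_vertices_of; apply: negbNE; apply: Fu.
rewrite ltnNge; apply/negP => S1.
have [i [u Su]] : exists i, exists u : X i, S \subset [set Tagged X u].
  (* An empty cover is placed inside the singleton of [v0], so that one argument treats both
     sizes. *)
  have [->|/set0Pn[[i u] iuS]] := eqVneq S set0.
    by exists (tag v0), (tagged v0); apply: sub0set.
  exists i, u; rewrite (eqP (_ : S == [set Tagged X u])) //.
  by rewrite eq_sym eqEcard sub1set iuS cards1.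
have [x xF /negP[]] := Fnt i u; rewrite -mem_vertices_of.
have /pred0Pn[v /andP[/= vS vx]] := forall_inP Scov x xF.
by move: (subsetP Su v vS); rewrite inE => /eqP <-.
Qed.

End MatchingCover.

(** * Comparison of [m0] with the maximum over intersecting graphs *)

Lemma graph_value_le_max a G : G \in intersecting_graphs ->
  (graph_value a G <= max_graph_value a)%R.
Proof. by move=> GI; apply: (le_bigmax_cond _ (graph_value a)). Qed.

Lemma set0_intersecting_graph : set0 \in intersecting_graphs.
Proof. by rewrite inE; apply/andP; split; apply/forall_inP => e; rewrite inE. Qed.

Theorem theorem4p3 (n : 'I_6 -> nat) (X : 'I_6 -> finType) (a : 'I_6 -> nat)
    (hX : forall i, #|X i| = n i)
    (hn : forall i, 2 <= n i)
    (ha : forall i, a i = n i - 1) :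
  ((m0 X 1)%:Z = (B2 a)%:Z + max_graph_value a)%R.
Proof.
have X2 i : 1 < #|X i| by rewrite hX.
have aE i : #|X i|.-1 = a i by rewrite hX ha subn1.
have [o _] : exists o : forall i, X i, forall i : 'I_6, true.
  apply: (fin_all_exists (P := fun i (q : X i) => true)) => i.
  by have /card_gt1P[s _] := X2 i; exists s.
have admissibleE (F : {set edge X}) :
    nu F <= 1 < tau F <-> intersecting F /\ nontrivial F.
  have := nu_le1P F isT; have := tau_gt1P F (Tagged X (o ord0)).
  by move=> [t1 t2] [n1 n2]; split=> [/andP[/n1 ? /t1 ?]|[/n2 -> /t2 ->]].
have lower G : G \in intersecting_graphs ->
    ((B2 a)%:Z + graph_value a G <= (m0 X 1)%:Z)%R.
  move=> GI; rewrite -zerosets_of_weight // lez_nat.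
  pose F := [set x : edge X | zeroset o x \in zerosets_of a G].
  have <- : #|F| = \sum_(Z in zerosets_of a G) weight a (~: Z).
    by rewrite card_zeroset_preim; apply: eq_bigr => Z _; apply: eq_bigr => i _.
  apply: (@leq_bigmax_cond _ _ (fun F : {set edge X} => #|F|)); apply/admissibleE; split.
    exact/intersecting_zeroset_preim/zerosets_of_intersecting.
  by apply: nontrivial_zeroset_preim => // Z Z5; rewrite inE Z5.
have upper (F : {set edge X}) : nu F <= 1 < tau F ->
    (#|F|%:Z <= (B2 a)%:Z + max_graph_value a)%R.
  case/admissibleE => Fint Fnt; have [T [Tint T1] le] := zeroset_bound o Fint Fnt.
  have [GI leT] := set_intersecting_le a Tint T1.
  have le' : #|F| <= \sum_(Z in T) weight a (~: Z).
    apply: leq_trans le _; apply: leq_sum => Z _; apply: leq_prod => i _.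
    by rewrite -aE spread_le.
  by have := graph_value_le_max a GI; move: le' leT; lia.
apply/eqP; rewrite eq_le; apply/andP; split.
  (* The empty maximum is 0; the empty graph, of value [Phi a set0], shows that the right side is
     nonnegative. *)
  rewrite /m0; elim/big_ind: _ => [|x y|F /upper] //.
    have := graph_value_le_max a set0_intersecting_graph.
    by rewrite /graph_value big_set0; lia.
  by rewrite /maxn; case: ifP.
rewrite -lerBrDl; apply: bigmax_le => [|G GI]; rewrite lerBrDl; apply: lower => //.
exact: set0_intersecting_graph.
Qed.
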